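(* Let $d\in\mathbb{N}^*$, let $a<b$ be reals, let $0<\alpha\le 1$, let $N\ge 2$ be an integer, $h=(b-a)/N$, $t_k=a+kh$ for $k=0,\ldots,N$, and let $L:\mathbb{R}^d\times\mathbb{R}^d\times[a,b]\to\mathbb{R}$, $(x,v,t)\mapsto L(x,v,t)$, be a $C^2$ map. Let $\boldsymbol{Q}=(Q_k)_{k=0,\ldots,N}\in(\mathbb{R}^d)^{N+1}$. Then $\boldsymbol{Q}$ is a discrete critical point of the discrete fractional Lagrangian functional $\mathcal{L}^\alpha_h$ if and only if $\boldsymbol{Q}$ is a solution of the discrete fractional Euler-Lagrange equation $$\forall k=1,\ldots,N-1,\qquad \frac{\partial L}{\partial x}\big(Q_k,(\Delta^\alpha_-\boldsymbol{Q})_k,t_k\big)+\Delta^\alpha_+\left(\frac{\partial L}{\partial v}(\boldsymbol{Q},\Delta^\alpha_-\boldsymbol{Q},\boldsymbol{T})\right)_k=0 .$$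
   Context: Coefficients: $\alpha_0:=1$ and, for every integer $r\ge 1$, $\alpha_r:=\dfrac{(-\alpha)(1-\alpha)\cdots(r-1-\alpha)}{r!}$. Discrete fractional derivatives (Grünwald-Letnikov): for $\boldsymbol{Q}=(Q_k)_{k=0,\ldots,N}\in(\mathbb{R}^d)^{N+1}$, $$(\Delta^\alpha_-\boldsymbol{Q})_k:=\frac{1}{h^\alpha}\sum_{r=0}^{k}\alpha_r Q_{k-r}\ \ (k=1,\ldots,N),\qquad (\Delta^\alpha_+\boldsymbol{Q})_k:=\frac{1}{h^\alpha}\sum_{r=0}^{N-k}\alpha_r Q_{k+r}\ \ (k=0,\ldots,N-1).$$ $\boldsymbol{T}:=(t_k)_{k=0,\ldots,N}$. The expression $\frac{\partial L}{\partial v}(\boldsymbol{Q},\Delta^\alpha_-\boldsymbol{Q},\boldsymbol{T})$ is understood componentwise: its $k$-th entry is $P_k:=\frac{\partial L}{\partial v}\big(Q_k,(\Delta^\alpha_-\boldsymbol{Q})_k,t_k\big)\in\mathbb{R}^d$ for $k=1,\ldots,N$, and $\Delta^\alpha_+(\cdot)_k$ for $1\le k\le N-1$ is $\frac{1}{h^\alpha}\sum_{r=0}^{N-k}\alpha_r P_{k+r}$, which only involves entries with index $\ge 1$. Here $\frac{\partial L}{\partial x}$ and $\frac{\partial L}{\partial v}$ are the gradients with respect to the first and second $\mathbb{R}^d$ variables. Discrete fractional Lagrangian functional: $\mathcal{L}^\alpha_h:(\mathbb{R}^d)^{N+1}\to\mathbb{R}$, $\mathcal{L}^\alpha_h(\boldsymbol{Q}):=h\sum_{k=1}^N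 L\big(Q_k,(\Delta^\alpha_-\boldsymbol{Q})_k,t_k\big)$. Discrete variations: $(\mathbb{R}^d)^{N+1}_0:=\{\boldsymbol{W}\in(\mathbb{R}^d)^{N+1}: W_0=W_N=0\}$. An element $\boldsymbol{Q}\in(\mathbb{R}^d)^{N+1}$ is a discrete critical point of $\mathcal{L}^\alpha_h$ if $D\mathcal{L}^\alpha_h(\boldsymbol{Q})(\boldsymbol{W})=0$ for every $\boldsymbol{W}\in(\mathbb{R}^d)^{N+1}_0$, where $$D\mathcal{L}^\alpha_h(\boldsymbol{Q})(\boldsymbol{W}):=\lim_{\varepsilon\to0}\frac{\mathcal{L}^\alpha_h(\boldsymbol{Q}+\varepsilon\boldsymbol{W})-\mathcal{L}^\alpha_h(\boldsymbol{Q})}{\varepsilon}.$$ *)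

(* Defs.v *)
From HB Require Import structures.
From mathcomp Require Import all_boot all_order all_algebra.
From mathcomp Require Import all_classical all_reals all_analysis.

Set Implicit Arguments.
Unset Strict Implicit.
Unset Printing Implicit Defensive.

Import Order.TTheory GRing.Theory Num.Theory.
Import numFieldNormedType.Exports.

Local Open Scope classical_set_scope.
Local Open Scope ring_scope.

(* A family (Q_0, ..., Q_N) of vectors of R^d is a matrix Q : 'M[R]_(N.+1, d);
   Q_k is its k-th row. *)

Section ContinuousDifferentiability.
Context {R : realType} {d : nat}.
Local Notation E := ('rV[R]_d * 'rV[R]_d * R)%type.

Definition dirx (i : 'I_d) : E := (delta_mx 0 i, 0, 0).
Definition dirv (i : 'I_d) : E := (0, delta_mx 0 i, 0).
Definition dirt : E := (0, 0, 1).

Definition coord_dir (u : E) : Prop :=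
  [\/ exists i, u = dirx i, exists i, u = dirv i | u = dirt].

(* R^d x R^d x [a, b] *)
Definition slab (a b : R) : set E := [set z | a <= z.2 <= b].

(* Filter of the nonzero e -> 0 such that z + e u stays in A.  For A = slab a b
   and a point with t = a or t = b, the derivative along dirt is the one-sided
   one; along dirx i and dirv i the restriction is void. *)
Definition dnbhs_in (A : set E) (z u : E) : set_system R :=
  within [set e : R | A (e *: u + z)] 0^'.

Definition dquot (f : E -> R) (z u : E) (e : R) : R :=
  e^-1 * (f (e *: u + z) - f z).

Definition derivable_in (A : set E) (f : E -> R) (z u : E) : Prop :=
  cvg (dquot f z u @ dnbhs_in A z u).

Definition derive_in (A : set E) (u : E) (f : E -> R) (z : E) : R :=
  lim (dquot f z u @ dnbhs_in A z u).

(* Class C^n on A: all iterated partial derivatives of order <= n exist on A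
   and are continuous on A; values of f outside A play no role. *)
Fixpoint class_C (A : set E) (n : nat) (f : E -> R) : Prop :=
  {within A, continuous f} /\
  if n is m.+1 then
    forall u, coord_dir u ->
      (forall z, A z -> derivable_in A f z u) /\ class_C A m (derive_in A u f)
  else True.

Definition gradx (L : E -> R) (z : E) : 'rV[R]_d := \row_i 'D_(dirx i) L z.
Definition gradv (L : E -> R) (z : E) : 'rV[R]_d := \row_i 'D_(dirv i) L z.

End ContinuousDifferentiability.

Definition step (R : realType) (a b : R) (N : nat) : R := (b - a) / N%:R.

Definition node (R : realType) (a b : R) (N k : nat) : R :=
  a + k%:R * step a b N.

Section DiscreteFractional.
Context {R : realType} {d N : nat}.
Local Notation E := ('rV[R]_d * 'rV[R]_d * R)%type.
Variables (a b alpha : R).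

Local Notation h := (step a b N).

Definition gl_coef (r : nat) : R :=
  (\prod_(j < r) (j%:R - alpha)) / r`!%:R.

(* The same formulas are also used at k = 0 for the left derivative and at
   k = N for the right one, so that the results are again families indexed by
   0..N; these extra entries occur neither in the functional nor in the
   Euler-Lagrange equation. *)
Definition gl_left (Q : 'M[R]_(N.+1, d)) : 'M[R]_(N.+1, d) :=
  \matrix_(k < N.+1)
    ((h `^ alpha)^-1 *:
       \sum_(r < k.+1) gl_coef r *: row (inord (k - r)) Q).

Definition gl_right (Q : 'M[R]_(N.+1, d)) : 'M[R]_(N.+1, d) :=
  \matrix_(k < N.+1)
    ((h `^ alpha)^-1 *:
       \sum_(r < (N - k).+1) gl_coef r *: row (inord (k + r)) Q).

Definition disc_point (Q : 'M[R]_(N.+1, d)) (k : 'I_N.+1) : E :=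
  (row k Q, row k (gl_left Q), node a b N k).

Variable L : E -> R.

Definition disc_lagrangian (Q : 'M[R]_(N.+1, d)) : R :=
  h * \sum_(k < N.+1 | (1 <= k)%N) L (disc_point Q k).

Definition disc_variation (W : 'M[R]_(N.+1, d)) : Prop :=
  row ord0 W = 0 /\ row ord_max W = 0.

(* is_derive Q W F 0: the limit defining the derivative of F at Q along W
   exists and equals 0. *)
Definition disc_critical (Q : 'M[R]_(N.+1, d)) : Prop :=
  forall W, disc_variation W -> is_derive Q W disc_lagrangian 0.

Definition disc_momentum (Q : 'M[R]_(N.+1, d)) : 'M[R]_(N.+1, d) :=
  \matrix_(k < N.+1) gradv L (disc_point Q k).

Definition disc_euler_lagrange (Q : 'M[R]_(N.+1, d)) : Prop :=
  forall k : 'I_N.+1, (1 <= k <= N.-1)%N ->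
    gradx L (disc_point Q k) + row k (gl_right (disc_momentum Q)) = 0.

End DiscreteFractional.

(* Main.v *)
(**
The derivative of the functional at Q along W with W_0 = 0 is
  h * sum_(k >= 1) W_k . (dL/dx + Delta_+ (dL/dv))_k,
by the chain rule at fixed t and by exchanging the order of summation in
sum_k (Delta_- W)_k . P_k = sum_k W_k . (Delta_+ P)_k.  Testing against the
variations supported at one interior node and one coordinate gives the
equivalence.  For the chain rule, the mean value theorem turns a continuous
partial derivative into a strict one; working only along directions that
preserve t keeps the base points in R^d x R^d x [a, b].
*)

Require Import Defs.
From HB Require Import structures.
From mathcomp Require Import all_boot all_order all_algebra.
From mathcomp Require Import all_classical all_reals all_analysis.
From mathcomp Require Import ring lra.
Import Order.TTheory GRing.Theory Num.Theory.
Import numFieldNormedType.Exports.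
Local Open Scope classical_set_scope.
Local Open Scope ring_scope.

(** * Strict directional derivatives relative to a set *)

Section StrictDerivative.
Context {R : realType} {V : normedModType R}.
Implicit Types (A : set V) (f : V -> R) (u w z : V).

Definition stable_along A u := forall y (e : R), A y -> A (e *: u + y).

(* Unlike directional derivatives, strict ones (uniform in a base point y
   near z) are additive in the direction. *)
Definition strict_derive_in A f z u (l : R) := forall eps : R, 0 < eps ->
  exists2 delta : R, 0 < delta & forall y (e : R), A y -> `|y - z| < delta ->
    `|e| < delta -> `|f (e *: u + y) - f y - e * l| <= eps * `|e|.

(** Both difference quotients are the same function of [e]. It serves for lines in [V] and for
    [disc_point] at a fixed index. *)
Lemma is_derive_affine (U : normedModType R) (p : U -> V) (f : V -> R)
    (x v : U) u (l : R) :
  (forall e : R, p (e *: v + x) = e *: u + p x) ->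
  is_derive (p x) u f l -> is_derive x v (f \o p) l.
Proof.
move=> pE [df fE].
have quotE : (fun e : R => e^-1 *: (((f \o p) \o shift x) (e *: v) - (f \o p) x))
    = (fun e : R => e^-1 *: ((f \o shift (p x)) (e *: u) - f (p x))).
  by apply/funext => e /=; rewrite pE.
by split; [rewrite /derivable quotE|rewrite /derive quotE].
Qed.

Lemma strict_derive_in0 A f z : strict_derive_in A f z 0 0.
Proof.
move=> eps eps0; exists 1 => // y e _ _ _.
by rewrite scaler0 add0r subrr mulr0 subrr normr0 mulr_ge0// ltW.
Qed.

(** Move by [e *: u], then by [e *: w]: stability keeps the intermediate point in [A], and
    uniformity in the base point handles the second move. *)
Lemma strict_derive_inD A f z u w (l m : R) : stable_along A u ->
  strict_derive_in A f z u l -> strict_derive_in A f z w m ->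
  strict_derive_in A f z (u + w) (l + m).
Proof.
move=> Au fu fw eps eps0.
have eps20 : 0 < eps / 2 by rewrite divr_gt0.
have [d1 d10 fud] := fu _ eps20.
have [d2 d20 fwd] := fw _ eps20.
have u1 : 0 < `|u| + 1 by rewrite ltr_wpDl.
(* One half of [d2] bounds [y - z], the other [e *: u]; the added 1 keeps the denominator positive
   when [u = 0]. *)
exists (Num.min d1 (Num.min (d2 / 2) (d2 / 2 / (`|u| + 1)))).
  by rewrite !lt_min d10 !divr_gt0.
move=> y e Ay; rewrite !lt_min => /and3P[y1 y2 _] /and3P[e1 e2 e3].
have Aeu := Au y e Ay.
have near2 : `|e *: u + y - z| < d2.
  rewrite -addrA (le_lt_trans (ler_normD _ _))// normrZ.
  have eu2 : `|e| * `|u| <= d2 / 2.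
    move: e3; rewrite ltr_pdivlMr// => /ltW; apply: le_trans.
    by rewrite ler_wpM2l// lerDl.
  lra.
have e2' : `|e| < d2 by lra.
have := fud y e Ay y1 e1; have := fwd _ e Aeu near2 e2'.
move=> b2 b1.
have -> : e *: (u + w) + y = e *: w + (e *: u + y).
  by rewrite scalerDr addrAC addrC.
have -> : f (e *: w + (e *: u + y)) - f y - e * (l + m) =
  (f (e *: w + (e *: u + y)) - f (e *: u + y) - e * m) +
  (f (e *: u + y) - f y - e * l) by ring.
rewrite (le_trans (ler_normD _ _))//; lra.
Qed.

(** A step [e] along [c *: u] is a step [e * c] along [u], so the tolerance and the radius are
    divided by [|c| + 1]. *)
Lemma strict_derive_inZ A f z u (c l : R) :
  strict_derive_in A f z u l -> strict_derive_in A f z (c *: u) (c * l).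
Proof.
move=> fu eps eps0.
have c1 : 0 < `|c| + 1 by rewrite ltr_wpDl.
have epsc : 0 < eps / (`|c| + 1) by rewrite divr_gt0.
have [d d0 fud] := fu _ epsc.
exists (Num.min d (d / (`|c| + 1))); first by rewrite lt_min d0 divr_gt0.
move=> y e Ay; rewrite !lt_min => /andP[y1 _] /andP[e1 e2].
have ec : `|e * c| < d.
  move: e2; rewrite ltr_pdivlMr// normrM; apply: le_lt_trans.
  by rewrite ler_wpM2l// lerDl.
have := fud y (e * c) Ay y1 ec.
rewrite scalerA mulrA => /le_trans; apply.
rewrite normrM mulrACA ler_piMr ?mulr_ge0 ?(ltW eps0)//.
by rewrite mulrC ler_pdivrMr// mul1r lerDl.
Qed.

Lemma strict_derive_in_sum A f z (I : Type) (s : seq I) (u : I -> V)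
    (c l : I -> R) :
  (forall i, stable_along A (u i)) ->
  (forall i, strict_derive_in A f z (u i) (l i)) ->
  strict_derive_in A f z (\sum_(i <- s) c i *: u i) (\sum_(i <- s) c i * l i).
Proof.
move=> Au fu; elim: s => [|i s IH].
  by rewrite !big_nil; exact: strict_derive_in0.
rewrite !big_cons; apply: strict_derive_inD => //; last exact: strict_derive_inZ.
by move=> y e Ay; rewrite scalerA; exact: Au.
Qed.

Lemma strict_derive_in_is_derive A f z u (l : R) : A z ->
  strict_derive_in A f z u l -> is_derive z u f l.
Proof.
move=> Az fu.
suff cvgl : (fun e : R => e^-1 *: ((f \o shift z) (e *: u) - f z)) @ 0^' --> l.
  by split; [apply/cvg_ex; exists l|exact: cvg_lim].
apply/cvgrPdist_le => /= eps eps0.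
have [d d0 fud] := fu _ eps0.
near=> e.
have e0 : e != 0 by near: e; exact: nbhs_dnbhs_neq.
have ed : `|e| < d by near: e; exact: dnbhs0_lt.
have := fud z e Az; rewrite subrr normr0 => /(_ d0 ed).
rewrite distrC -ler_pdivrMr ?normr_gt0// -normfV -normrM.
set D := f _ - _.
by rewrite mulrBl mulrAC mulfV// mul1r [_ *: _]mulrC.
Unshelve. all: by end_near. Qed.

(** Locating [c] by its absolute value covers both signs of [e]. *)
Lemma mean_value_at0 (g dg : R -> R) (e : R) :
  (forall s : R, is_derive s 1 g (dg s)) ->
  exists2 c : R, `|c| <= `|e| & g e - g 0 = dg c * e.
Proof.
move=> gd.
have gc (i : interval R) : {within [set` i], continuous g}.
  by apply: derivable_within_continuous => s _; exact: ex_derive.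
have [e0|e0] := leP 0 e.
  have [c] := MVT_segment e0 (fun s _ => gd s) (gc _).
  rewrite in_itv/= => /andP[c0 ce] gE; exists c; last by rewrite gE subr0.
  by rewrite !ger0_norm// (le_trans c0).
have [c] := MVT_segment (ltW e0) (fun s _ => gd s) (gc _).
rewrite in_itv/= => /andP[ec c0] gE; exists c.
  by rewrite !ler0_norm ?lerN2// ltW.
by rewrite -opprB gE sub0r mulrN opprK.
Qed.

(** By the mean value theorem the increment is [e] times ['D_u f] at some [c *: u + y], a point of
    [A] near [z], where continuity applies. *)
Lemma strict_derive_in_continuous A f z u : A z -> stable_along A u ->
  (forall y, A y -> derivable f y u) ->
  {within A, continuous (fun y => 'D_u f y)} ->
  strict_derive_in A f z u ('D_u f z).
Proof.
move=> Az Au fd fc eps eps0.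
have /cvgr_dist_le/(_ _ eps0) := (subspace_continuousP _ _).1 fc z Az.
rewrite /within/= => /nbhs_ballP[d /= d0 dball].
have u1 : 0 < `|u| + 1 by rewrite ltr_wpDl.
exists (Num.min (d / 2) (d / 2 / (`|u| + 1))); first by rewrite lt_min !divr_gt0.
move=> y e Ay; rewrite !lt_min => /andP[y2 _] /andP[_ e2].
have gd (s : R) : is_derive s 1 (f \o (fun s => s *: u + y)) ('D_u f (s *: u + y)).
  apply: is_derive_affine; last by apply: derivableP; exact/fd/Au.
  by move=> r; rewrite scalerDl addrA [r *: 1]mulr1.
have [c ce /= ] := mean_value_at0 _ _ e gd.
rewrite scale0r add0r => ->.
rewrite [_ * e]mulrC -mulrBr normrM mulrC ler_wpM2r// distrC.
apply: dball; last exact: Au.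
rewrite -ball_normE/= distrC -addrA (le_lt_trans (ler_normD _ _))// normrZ.
have cu : `|c| * `|u| <= d / 2.
  move: e2; rewrite ltr_pdivlMr// => /ltW; apply: le_trans.
  by apply: ler_pM => //; rewrite lerDl.
lra.
Qed.

End StrictDerivative.

(** * The chain rule at fixed time *)

Section SlabDerivatives.
Context {R : realType} {d : nat}.
Local Notation E := ('rV[R]_d * 'rV[R]_d * R)%type.
Implicit Types (L : E -> R) (u z : E) (x v : 'rV[R]_d) (a b : R).

Lemma slab_stable a b u : u.2 = 0 -> stable_along (slab a b) u.
Proof. by move=> u0 y e; rewrite /slab/= u0 scaler0 add0r. Qed.

(** Every step stays in [A], so the derivatives in [class_C] along such a direction are the ordinary
    ones. *)
Lemma dnbhs_in_stable (A : set E) z u : A z -> stable_along A u ->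
  dnbhs_in A z u = 0^'.
Proof.
move=> Az Au; apply/seteqP; split => P; rewrite /dnbhs_in /within/= => FP.
  by apply: filterS FP => e; apply; exact: (Au z e Az).
by apply: filterS FP.
Qed.

Lemma class_C2_strict a b L u z : class_C (slab a b) 2 L ->
  coord_dir u -> u.2 = 0 -> slab a b z ->
  strict_derive_in (slab a b) L z u ('D_u L z).
Proof.
move=> [_ L1] cu u0 Az; have [Ld [Lc _]] := L1 u cu.
have Au := slab_stable a b _ u0.
apply: strict_derive_in_continuous => //.
  by move=> y Ay; have := Ld y Ay; rewrite /derivable_in dnbhs_in_stable.
apply: subspace_eq_continuous Lc => y; rewrite inE => Ay.
by rewrite /from_subspace /derive_in dnbhs_in_stable.
Qed.

Lemma sum_dirx x : \sum_i x 0 i *: dirx i = (x, 0, 0) :> E.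
Proof.
rewrite [in RHS](row_sum_delta x); elim/big_rec2: _ => // i p q _ ->.
by rewrite /dirx; congr (_, _, _); rewrite /= ?scaler0 ?addr0.
Qed.

Lemma sum_dirv v : \sum_i v 0 i *: dirv i = (0, v, 0) :> E.
Proof.
rewrite [in RHS](row_sum_delta v); elim/big_rec2: _ => // i p q _ ->.
by rewrite /dirv; congr (_, _, _); rewrite /= ?scaler0 ?addr0.
Qed.

(** Expand the direction in coordinate directions, add the strict derivatives, and only then pass to
    the ordinary derivative. *)
Lemma is_derive_slab a b L z x v : class_C (slab a b) 2 L -> slab a b z ->
  is_derive z (x, v, 0) L
    (\sum_i x 0 i * gradx L z 0 i + \sum_i v 0 i * gradv L z 0 i).
Proof.
move=> LC Az; apply: (strict_derive_in_is_derive (slab a b)) => //.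
have -> : (x, v, 0) = \sum_i x 0 i *: dirx i + \sum_i v 0 i *: dirv i :> E.
  by rewrite sum_dirx sum_dirv; congr (_, _, _); rewrite /= ?add0r ?addr0.
apply: strict_derive_inD.
- by apply: slab_stable; rewrite sum_dirx.
- apply: strict_derive_in_sum => i; first exact: slab_stable.
  by rewrite mxE; apply: class_C2_strict => //; constructor 1; exists i.
- apply: strict_derive_in_sum => i; first exact: slab_stable.
  by rewrite mxE; apply: class_C2_strict => //; constructor 2; exists i.
Qed.

End SlabDerivatives.

(** * Fractional summation by parts and the derivative of the functional *)

Section DiscreteEulerLagrange.
Context {R : realType} {d N : nat}.
Variables (a b alpha : R).
Implicit Types (Q W P : 'M[R]_(N.+1, d)) (k : 'I_N.+1) (i : 'I_d).
Local Notation E := ('rV[R]_d * 'rV[R]_d * R)%type.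
Local Notation scale := ((step a b N `^ alpha)^-1).
Local Notation gl_left := (@gl_left R d N a b alpha).
Local Notation gl_right := (@gl_right R d N a b alpha).
Local Notation disc_point := (@disc_point R d N a b alpha).

(** Substituting [j = k - r] here, and [j = k + r] for [gl_right], shows the two operators as
    transposed triangular kernels. *)
Lemma gl_leftE Q k i : gl_left Q k i =
  scale * \sum_(j < N.+1 | (j <= k)%N) gl_coef alpha (k - j) * Q j i.
Proof.
rewrite !mxE summxE; congr (_ * _).
rewrite (reindex_inj rev_ord_inj)/=.
rewrite (eq_bigr (fun r : 'I_k.+1 => gl_coef alpha (k - r) * Q (inord r) i)).
  rewrite (big_ord_widen N.+1 (fun r => gl_coef alpha (k - r) * Q (inord r) i))//.
  by apply: eq_big => j //; rewrite inord_val.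
by move=> r _; rewrite !mxE subSS subKn// -ltnS.
Qed.

Lemma gl_rightE P k i : gl_right P k i =
  scale * \sum_(j < N.+1 | (k <= j)%N) gl_coef alpha (j - k) * P j i.
Proof.
rewrite !mxE summxE; congr (_ * _).
rewrite (eq_bigr (fun j : 'I_N.+1 => gl_coef alpha (j - k) * P (inord j) i));
  last by move=> j _; rewrite inord_val.
rewrite -(big_geq_mkord k N.+1 xpredT (fun j => gl_coef alpha (j - k) * P (inord j) i)).
have := big_addn 0 N.+1 k xpredT (fun j => gl_coef alpha (j - k) * P (inord j) i).
rewrite add0n => ->; rewrite subSn -1?ltnS// big_mkord.
by apply: eq_bigr => r _; rewrite !mxE addnK addnC.
Qed.

(** The kernels are transposes of each other; [W ord0 i = 0] removes the column [j = 0], so both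
    indices run over 1..N. *)
Lemma gl_left_summation_by_parts W P i : W ord0 i = 0 ->
  \sum_(k < N.+1 | (1 <= k)%N) gl_left W k i * P k i =
  \sum_(k < N.+1 | (1 <= k)%N) W k i * gl_right P k i.
Proof.
move=> W0.
under eq_bigr => k _.
  rewrite gl_leftE (bigID (fun j : 'I_N.+1 => (1 <= j)%N))/= [X in _ + X]big1.
    rewrite addr0 mulr_sumr mulr_suml; over.
  move=> j /andP[_]; rewrite -eqn0Ngt => /eqP j0.
  by rewrite (_ : j = ord0) ?W0 ?mulr0//; exact: val_inj.
rewrite (exchange_big_dep (fun j : 'I_N.+1 => (1 <= j)%N))/=;
  last by move=> k j _ /andP[].
apply: eq_bigr => j j1; rewrite gl_rightE mulrCA mulr_sumr mulr_sumr.
apply: eq_big => k; first by rewrite j1 andbT; apply: andb_idl => /(leq_trans j1).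
by move=> _; ring.
Qed.

Lemma gl_leftP Q W (e : R) : gl_left (e *: W + Q) = e *: gl_left W + gl_left Q.
Proof.
apply/matrixP => k i; rewrite [RHS]mxE [X in _ = X + _]mxE !gl_leftE.
rewrite mulrCA -mulrDr [e * _]mulr_sumr -big_split/=; congr (_ * _).
by apply: eq_bigr => j _; rewrite !mxE; ring.
Qed.

(** The nodes do not depend on the family, hence the zero time component, which keeps the line in
    the slab. *)
Lemma disc_point_affine Q W k (e : R) : disc_point (e *: W + Q) k =
  e *: ((row k W, row k (gl_left W), 0) : E) + disc_point Q k.
Proof.
rewrite /disc_point gl_leftP !linearP.
by congr (_, _, _); rewrite /= scaler0 add0r.
Qed.

Lemma slab_disc_point Q k : a <= b -> slab a b (disc_point Q k).
Proof.
move=> ab; rewrite /slab/= /node /step.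
case: N k => [|n] k.
  by rewrite ord1 mul0r addr0 lexx.
(* The node is the convex combination of [a] and [b] with weight [k / N]. *)
have : 0 <= (k%:R / n.+1%:R : R) <= 1.
  by rewrite divr_ge0//= ler_pdivrMr// mul1r ler_nat -ltnS.
rewrite mulrCA; set t := k%:R / _ => /andP[t0 t1]; apply/andP; split; nra.
Qed.

Lemma is_derive_disc_lagrangian (L : E -> R) Q W : a <= b ->
  class_C (slab a b) 2 L -> row ord0 W = 0 ->
  is_derive Q W (disc_lagrangian a b alpha L)
    (step a b N * \sum_(k < N.+1 | (1 <= k)%N) \sum_i W k i *
      (gradx L (disc_point Q k) +
       row k (gl_right (disc_momentum a b alpha L Q))) 0 i).
Proof.
move=> ab LC /rowP W0.
pose dL k := \sum_i row k W 0 i * gradx L (disc_point Q k) 0 i +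
  \sum_i row k (gl_left W) 0 i * gradv L (disc_point Q k) 0 i.
have LD k : is_derive Q W (fun Q => L (disc_point Q k)) (dL k).
  apply: (is_derive_affine _ (disc_point ^~ k)) => [e|].
    exact: disc_point_affine.
  exact: is_derive_slab LC (slab_disc_point Q k ab).
have SD : is_derive Q W (\sum_(k < N.+1 | (1 <= k)%N) fun Q => L (disc_point Q k))
    (\sum_(k < N.+1 | (1 <= k)%N) dL k).
  by elim/big_ind2 : _ => // [|] *; [exact: is_derive_cst|exact: is_deriveD].
have -> : disc_lagrangian a b alpha L = step a b N \*:
    (\sum_(k < N.+1 | (1 <= k)%N) fun Q => L (disc_point Q k)).
  by apply/funext => Q'; rewrite /disc_lagrangian/= fct_sumE.
apply: is_derive_eq; congr (_ * _); rewrite big_split/=.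
under [RHS]eq_bigr do (under eq_bigr do rewrite mxE mulrDr; rewrite big_split/=).
rewrite [RHS]big_split/=; congr (_ + _).
  by apply: eq_bigr => k _; apply: eq_bigr => i _; rewrite [row k W 0 i]mxE.
(* The coordinate sum goes outside, since summation by parts is applied coordinate by coordinate. *)
rewrite exchange_big [RHS]exchange_big/=; apply: eq_bigr => i _.
under [RHS]eq_bigr do rewrite [row _ _ 0 i]mxE.
rewrite -gl_left_summation_by_parts; last by have := W0 i; rewrite !mxE.
by apply: eq_bigr => k _; rewrite [row k _ 0 i]mxE [disc_momentum _ _ _ _ _ k i]mxE.
Qed.

End DiscreteEulerLagrange.

(** * Criticality and the Euler-Lagrange equation *)

Theorem theorem1 (R : realType) (d N : nat) (a b alpha : R)
    (L : 'rV[R]_d * 'rV[R]_d * R -> R) (Q : 'M[R]_(N.+1, d)) :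
  (1 <= d)%N -> (2 <= N)%N -> a < b -> 0 < alpha <= 1 ->
  class_C (slab a b) 2 L ->
  disc_critical a b alpha L Q <-> disc_euler_lagrange a b alpha L Q.
Proof.
move=> _ N2 ab _ LC; split => [crit k /andP[k1 kN]|EL W [W0 WN]].
  have h0 : step a b N != 0.
    by rewrite mulf_neq0// ?invr_eq0 ?subr_eq0 ?gt_eqF// ltr0n (leq_trans _ N2).
  apply/rowP => i; rewrite [RHS]mxE.
  (* The test variation [delta_mx k i] vanishes at both ends because [k] is interior. *)
  have W0 : row ord0 (delta_mx k i) = 0 :> 'rV[R]_d.
    by apply/rowP => j; rewrite !mxE -val_eqE/= eq_sym (gtn_eqF k1).
  have WN : row ord_max (delta_mx k i) = 0 :> 'rV[R]_d.
    apply/rowP => j; rewrite !mxE -val_eqE/= gtn_eqF//.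
    by rewrite (leq_ltn_trans kN)// prednK// (leq_trans _ N2).
  have D := is_derive_disc_lagrangian a b alpha L Q _ (ltW ab) LC W0.
  have D0 := crit _ (conj W0 WN).
  (* Uniqueness of the derivative equates the formula with 0; after cancelling the step, only the
     term of indices [k], [i] survives. *)
  move: (@derive_val _ _ _ _ _ _ _ D); rewrite (@derive_val _ _ _ _ _ _ _ D0).
  move=> /esym/eqP; rewrite mulf_eq0 (negPf h0)/= => /eqP.
  rewrite (bigD1 k)//= [X in _ + X]big1 ?addr0 => [|j /andP[_ /negPf jk]].
    rewrite (bigD1 i)//= [X in _ + X]big1 ?addr0 => [|j /negPf ji].
      by rewrite [delta_mx k i k i]mxE !eqxx mul1r.
    by rewrite [delta_mx k i k j]mxE ji andbF mul0r.
  by rewrite big1// => l _; rewrite [delta_mx k i j l]mxE jk mul0r.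
apply: (is_derive_eq (is_derive_disc_lagrangian a b alpha L Q W (ltW ab) LC W0)).
rewrite big1 ?mulr0// => k k1; rewrite big1// => i _.
(* The equation says nothing at [k = N]; there the term vanishes because [W] does. *)
have [->|kN] := eqVneq k ord_max.
  by move/rowP/(_ i): WN; rewrite !mxE => ->; rewrite mul0r.
have kltN : (k < N)%N by rewrite ltn_neqAle leq_ord andbT.
rewrite EL; first by rewrite mxE mulr0.
by rewrite k1 -ltnS prednK// (leq_trans _ N2).
Qed.
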